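(* Let $A,B\subset\mathbb{R}^2$ be two non-empty compact connected sets that are $ch$-disjoint. Then there exist $R>0$ and two disjoint rays $\vec r_1,\vec r_2$ in $\mathbb{R}^2$ such that the set $$M:=\{A=B\}\cap B(0,R)^c$$ consists exactly of two asymptotic ends, in the direction of $\vec r_1$ and $\vec r_2$ respectively; that is, $M$ has an asymptotic end in the direction of $\vec r_1$ (with some width $\varepsilon_1>0$) and an asymptotic end in the direction of $\vec r_2$ (with some width $\varepsilon_2>0$), and $M$ is the disjoint union of $M\cap tub_{\varepsilon_1}(\vec r_1)$ and $M\cap tub_{\varepsilon_2}(\vec r_2)$.
   Context: $\mathbb{R}^2$ carries the Euclidean distance $dist$; $\{A=B\}:=\{x\in\mathbb{R}^2 : dist(x,A)=dist(x,B)\}$; $B(0,R)$ is the open ball of radius $R$ centered at the origin and $B(0,R)^c$ its complement. Two non-empty compact connected sets $A,B$ are $ch$-disjoint if their convex hulls are disjoint: $ch(A)\cap ch(B)=\emptyset$. A ray is a set $\vec r=[a,\infty)_v:=\{a+tv : t\ge 0\}$ with $a,v\in\mathbb{R}^2$, $\|v\|=1$. Let $v^\perp$ be such that $\{v,v^\perp\}$ is a positively oriented orthonormal basis. For $\varepsilon>0$ the tube of width $\varepsilon$ around $\vec r$ is $tub_\varepsilon(\vec r):=\{a+tv+sv^\perp : t\ge 0,\ |s|\le\varepsilon\}$. A set $M\subset\mathbb{R}^2$ has an asymptotic end in the direction of $\vec r$ (with width $\varepsilon$) if there is $\varepsilon>0$ such that $M_{\varepsilon,\vec r}:=M\cap tub_\varepsilon(\vec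 r)$ satisfies: (i) the orthogonal projection from $M_{\varepsilon,\vec r}$ to $\vec r$ is a bijection, so that in the parameters $(t,s)$ of the tube $M_{\varepsilon,\vec r}$ is the graph of a function $s:[0,\infty)\to[-\varepsilon,\varepsilon]$, $t\mapsto s(t)$; and (ii) $\lim_{t\to\infty}s(t)=0$. *)

(* Defs.v *)
From HB Require Import structures.
From mathcomp Require Import all_boot all_order all_algebra.
From mathcomp Require Import all_classical all_reals all_analysis.

Set Implicit Arguments.
Unset Strict Implicit.
Unset Printing Implicit Defensive.

Import Order.TTheory GRing.Theory Num.Theory.
Import numFieldNormedType.Exports.

Local Open Scope classical_set_scope.
Local Open Scope ring_scope.

Definition dot (R : realType) (u v : 'rV[R]_2) : R := \sum_j u 0 j * v 0 j.

(* The library norm `|u| on 'rV[R]_2 is the sup norm.  It induces the same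
   topology as eucl_norm, so the library's compact and connected are used
   as they are, but distances are measured with eucl_norm. *)
Definition eucl_norm (R : realType) (u : 'rV[R]_2) : R := Num.sqrt (dot u u).

Definition eucl_ball (R : realType) (r : R) : set 'rV[R]_2 :=
  [set x | eucl_norm x < r].

(* The infimum is meaningful only for A != set0: inf set0 = 0. *)
Definition dist (R : realType) (x : 'rV[R]_2) (A : set 'rV[R]_2) : R :=
  inf [set eucl_norm (x - y) | y in A].

Definition equidistant (R : realType) (A B : set 'rV[R]_2) : set 'rV[R]_2 :=
  [set x | dist x A = dist x B].

(* The intersection of all convex sets containing A. *)
Definition convex_hull (R : realType) (A : set 'rV[R]_2) : set 'rV[R]_2 :=
  smallest (@convex_set R 'rV[R]_2) A.

Definition ch_disjoint (R : realType) (A B : set 'rV[R]_2) : Prop :=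
  convex_hull A `&` convex_hull B = set0.

Record ray (R : realType) := Ray {
  ray_origin : 'rV[R]_2;
  ray_dir : 'rV[R]_2;
  ray_dir_unit : eucl_norm ray_dir = 1 }.

(* Rotation by a positive right angle: (v0, v1) |-> (- v1, v0). *)
Definition perp (R : realType) (v : 'rV[R]_2) : 'rV[R]_2 :=
  \row_j (if j == 0 then - v 0 1 else v 0 0).

Definition ray_set (R : realType) (r : ray R) : set 'rV[R]_2 :=
  [set ray_origin r + t *: ray_dir r | t in `[0, +oo[].

Definition tube_point (R : realType) (r : ray R) (t s : R) : 'rV[R]_2 :=
  ray_origin r + t *: ray_dir r + s *: perp (ray_dir r).

Definition tube (R : realType) (e : R) (r : ray R) : set 'rV[R]_2 :=
  [set x | exists t s : R, [/\ 0 <= t, `|s| <= e & x = tube_point r t s]].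

(* Orthogonal projection onto the line carrying r; it maps tube e r into
   ray_set r. *)
Definition ray_proj (R : realType) (r : ray R) (x : 'rV[R]_2) : 'rV[R]_2 :=
  ray_origin r + dot (x - ray_origin r) (ray_dir r) *: ray_dir r.

(* M has an asymptotic end in the direction of r, with width e.  The function
   s is only relevant on [0, +oo[; there it is determined by the graph
   equation. *)
Definition asymptotic_end (R : realType) (M : set 'rV[R]_2) (r : ray R)
    (e : R) : Prop :=
  [/\ 0 < e,
      set_bij (M `&` tube e r) (ray_set r) (ray_proj r) &
      exists s : R -> R,
        [/\ forall t, 0 <= t -> `|s t| <= e,
            M `&` tube e r = [set tube_point r t (s t) | t in `[0, +oo[] &
            s t @[t --> +oo] --> 0]].

(* Main.v *)
(* Write |x|^2 - dist(x, X)^2 = power X x := sup_{a in X} (2<x,a> - |a|^2); then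
   {A = B} is the zero set of gap := power B - power A.  Separate the hulls by
   <b - a, w> >= c > 0.  Comparing maximizers, gap increases with slope at least
   2c along w.

   Let e be orthogonal to w.  On the half plane <x,e> >= 0 consider the unit
   vector v, <v,e> > 0, in which A and B have the same support value h: it is the
   outer normal of a common support line.  Since power X (t v) = 2 t h + O(1) for
   X = A and X = B, the zeros t v + s v^perp of gap have bounded s.  For such
   points and t large, the maximizers defining power A and power B are close to
   the common support line, so that separation along w becomes separation along
   v^perp and gap is strictly increasing in s: its zero set is the graph of a
   Lipschitz function g(t).  For fixed s, power X (t v + s v^perp) - 2 t h is
   nonincreasing and bounded below in t, hence gap converges as t -> oo, and g
   converges to the zero of the limit.  Finally t^2 + g(t)^2 is increasing for
   large t, so that the complement of a ball cuts the graph at a single t0.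
   The half plane <x,e> <= 0 follows by exchanging A and B. *)
Require Import Defs.
From HB Require Import structures.
From mathcomp Require Import all_boot all_order all_algebra.
From mathcomp Require Import all_classical all_reals all_analysis.
From mathcomp Require Import ring lra.
Import Order.TTheory GRing.Theory Num.Theory.
Import numFieldNormedType.Exports.
Local Open Scope classical_set_scope.
Local Open Scope ring_scope.

(** * Real functions: roots, limits, and roots depending on a parameter *)

Section RealFunctions.
Context {R : realType}.
Implicit Types (f : R -> R) (l t s : R).

Lemma sqr_le_of_norm {t s} : `|t| <= s -> t ^+ 2 <= s ^+ 2.
Proof.
move=> ts; have s0 := le_trans (normr_ge0 t) ts.
by rewrite -real_normK ?num_real// ler_sqr ?nnegrE.
Qed.

(** If |t| < T, then t^2 + s^2 < T^2 + S^2 <= (T + S)^2. This forces points of a strip that lie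
    outside a large ball far out along the strip. *)
Lemma large_abscissa {T S t s rho : R} : 0 <= T -> 0 <= S -> `|s| <= S ->
  T + S <= rho -> rho ^+ 2 <= t ^+ 2 + s ^+ 2 -> T <= `|t|.
Proof.
move=> T0 S0 sS hrho hle; rewrite leNgt; apply/negP => tT.
have h1 := sqr_le_of_norm sS.
have h2 : `|t| ^+ 2 < T ^+ 2 by rewrite ltr_sqr ?nnegrE.
rewrite real_normK ?num_real// in h2.
have h3 : (T + S) ^+ 2 <= rho ^+ 2 by rewrite ler_sqr ?nnegrE; lra.
have := mulr_ge0 T0 S0; lra.
Qed.

Lemma lipschitz_continuous f (L : R) :
  (forall s t, `|f s - f t| <= L * `|s - t|) -> continuous f.
Proof.
move=> fL t; apply/cvgrPdist_lt => e e0.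
have L0 : 0 <= L.
  by have := fL 1 0; rewrite subr0 normr1 mulr1; apply: le_trans.
have L1 : 0 < L + 1 by lra.
near=> s.
have st : `|t - s| < e / (L + 1).
  near: s; apply: (@cvgr_dist_lt _ _ _ _ _ id); first exact: cvg_id.
  by rewrite divr_gt0.
apply: le_lt_trans (fL t s) _.
move: st; rewrite ltr_pdivlMr// => st.
by apply: le_lt_trans st; rewrite mulrC ler_wpM2l//; lra.
Unshelve. all: by end_near. Qed.

Lemma continuous_root f (a b : R) : continuous f -> a <= b ->
  f a <= 0 -> 0 <= f b -> exists2 t, a <= t <= b & f t = 0.
Proof.
move=> cf ab fa fb.
have [||t] := @IVT _ f a b 0 ab; first exact: continuous_subspaceT.
  by rewrite ge_min fa le_max fb orbT.
by rewrite in_itv /=; exists t.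
Qed.

Lemma nonincreasing_cvgr_pinfty f (m : R) :
  {homo f : s t / s <= t >-> t <= s} -> (forall t, m <= f t) ->
  f t @[t --> +oo] --> inf (range f).
Proof.
move=> fd fm; apply/cvgrPdist_lt => e e0.
have hi : has_inf (range f).
  by split; [exists (f 0), 0|exists m => _ [t _ <-]; exact: fm].
have [_ [t0 _ <-] ht0] := inf_adherent e0 hi.
near=> t.
have tt0 : t0 <= t by near: t; exact: nbhs_pinfty_ge (num_real _).
have h1 : inf (range f) <= f t by apply: ge_inf; [exact: hi.2|exists t].
have h2 := fd _ _ tt0.
by rewrite ler0_norm; lra.
Unshelve. all: by end_near. Qed.

(** Slope at least c in s means that an error in the value of [f] moves the root by at most 1/c
    times that error, whence the Lipschitz bound. The pointwise limit as t -> oo inherits the slope,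
    and the roots converge to its sign change. *)
Lemma asymptotic_root (f : R -> R -> R) (T S c L : R) :
  0 < c -> 0 <= S ->
  (forall t s s', T <= t -> - S <= s -> s <= s' -> s' <= S ->
    c * (s' - s) <= f t s' - f t s) ->
  (forall t t' s s', `|f t s - f t' s'| <= L * (`|t - t'| + `|s - s'|)) ->
  (forall t, T <= t -> f t (- S) < 0 /\ 0 < f t S) ->
  (forall s, exists l, f t s @[t --> +oo] --> l) ->
  exists (g : R -> R) (l : R),
    [/\ forall t, T <= t -> `|g t| < S /\ f t (g t) = 0,
        forall t t', T <= t -> T <= t' -> `|g t - g t'| <= L / c * `|t - t'|,
        continuous g, g t @[t --> +oo] --> l & `|l| <= S].
Proof.
move=> c0 S0 fmono fL fS fcvg.
have root t : exists s, T <= t -> `|s| < S /\ f t s = 0.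
  have [Tt|tT] := leP T t; last by exists 0.
  have [fS1 fS2] := fS _ Tt.
  have cf : continuous (f t).
    apply: (lipschitz_continuous _ L) => s s'.
    by have := fL t t s s'; rewrite subrr normr0 add0r.
  have [|||s /andP[s1 s2] fs] := continuous_root (f t) (- S) S cf; try lra.
  exists s => _; split=> //; rewrite ltr_norml !lt_neqAle s1 s2 !andbT.
  by apply/andP; split; apply/eqP => sE; move: fs; [rewrite -sE|rewrite sE]; lra.
have [h hP] := choice root.
have hS t : T <= t -> - S <= h t <= S.
  by move=> Tt; have [] := hP t Tt; rewrite ltr_norml => /andP[? ?] _; lra.
have hL t t' : T <= t -> T <= t' -> `|h t - h t'| <= L / c * `|t - t'|.
  move=> Tt Tt'.
  wlog hh : t t' Tt Tt' / h t' <= h t => [th|].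
    have /orP[hh|hh] := le_total (h t') (h t); first exact: th.
    by rewrite distrC [`|t - t'|]distrC; exact: th.
  have [_ ft] := hP t Tt; have [_ ft'] := hP t' Tt'.
  rewrite ger0_norm ?subr_ge0// mulrAC ler_pdivlMr// mulrC.
  have [h1 h2] := (andP (hS _ Tt), andP (hS _ Tt')).
  (* Both roots are compared on the slice t', where f t' (h t) differs from f t (h t) = 0 by at most
     L |t - t'|. *)
  apply: le_trans (fmono t' _ _ Tt' h2.1 hh h1.2) _.
  rewrite ft' subr0 -[leLHS]subr0 -ft.
  apply: le_trans (ler_norm _) _; apply: le_trans (fL _ _ _ _) _.
  by rewrite subrr normr0 addr0 distrC.
have [l lP] := choice fcvg.
have lmono s s' : - S <= s -> s <= s' -> s' <= S ->
    c * (s' - s) <= l s' - l s.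
  move=> hs ss' hs'.
  apply: (@cvgr_to_ge _ _ _ _ _ _ _ (cvgB (lP s') (lP s))).
  by near=> t; apply: fmono => //; near: t; exact: nbhs_pinfty_ge (num_real _).
have lS1 : l (- S) <= 0.
  apply: (@cvgr_to_le _ _ _ _ _ _ _ (lP (- S))).
  near=> t; have [|/ltW//] := fS t; near: t; exact: nbhs_pinfty_ge (num_real _).
have lS2 : 0 <= l S.
  apply: (@cvgr_to_ge _ _ _ _ _ _ _ (lP S)).
  near=> t; have [|_ /ltW//] := fS t; near: t; exact: nbhs_pinfty_ge (num_real _).
(* Below, only the sign of [l] on either side of the supremum [s0] enters; [s0] may be an endpoint
   of the strip. *)
pose E := [set s | - S <= s <= S /\ l s <= 0].
have ES : E (- S) by split=> //; apply/andP; split; lra.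
have Eu : has_ubound E by exists S => s [/andP[]].
pose s0 := sup E.
have s0S : - S <= s0 <= S.
  rewrite (ub_le_sup Eu ES) /=; apply: ge_sup; first by exists (- S).
  by move=> s [/andP[]].
have l_pos s : s0 < s -> s <= S -> 0 < l s.
  move=> hs sS; have h2 : - S <= s by move: s0S; lra.
  rewrite ltNge; apply/negP => ls.
  suff : s <= s0 by lra.
  by apply: ub_le_sup => //; split=> //; rewrite h2.
have l_neg s : s < s0 -> - S <= s -> l s < 0.
  move=> hs sS.
  have [s' [/andP[s'1 s'2] ls'] ss'] : exists2 s', E s' & s < s'.
    have [||s' Es' h'] := @sup_adherent _ E (s0 - s).
    - by rewrite subr_gt0.
    - by split; [exists (- S)|].
    by exists s' => //; move: h'; rewrite -/s0; lra.
  have := lmono s s' sS (ltW ss') s'2.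
  have : 0 < c * (s' - s) by rewrite mulr_gt0// subr_gt0.
  lra.
have hcvg : h t @[t --> +oo] --> s0.
  apply/cvgrPdist_lt => e e0.
  (* The guard covers the case where s0 - e leaves the strip: then - S < h t already gives the
     bound. *)
  have lft : \forall t \near +oo, - S < s0 - e -> f t (s0 - e) < 0.
    have [sS|sS] := ltP (- S) (s0 - e); last by near=> t.
    have le : l (s0 - e) < 0 by apply: l_neg; lra.
    by near=> t => _; near: t; exact: cvgr_lt (lP (s0 - e)) _ le.
  have rgt : \forall t \near +oo, s0 + e < S -> 0 < f t (s0 + e).
    have [sS|sS] := ltP (s0 + e) S; last by near=> t.
    have le : 0 < l (s0 + e) by apply: l_pos; lra.
    by near=> t => _; near: t; exact: cvgr_gt (lP (s0 + e)) _ le.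
  near=> t.
  have Tt : T <= t by near: t; exact: nbhs_pinfty_ge (num_real _).
  have ft1 : - S < s0 - e -> f t (s0 - e) < 0 by near: t.
  have ft2 : s0 + e < S -> 0 < f t (s0 + e) by near: t.
  have [hS1 fh] := hP t Tt; move: hS1; rewrite ltr_norml => /andP[hS1 hS2].
  rewrite ltr_distlC; apply/andP; split.
    have [sS|sS] := leP (s0 - e) (- S); first lra.
    rewrite ltNge; apply/negP => hle.
    have ft := ft1 sS.
    have := fmono t (h t) (s0 - e) Tt (ltW hS1) hle.
    have : 0 <= c * (s0 - e - h t) by rewrite mulr_ge0//; lra.
    lra.
  have [sS|sS] := leP S (s0 + e); first lra.
  rewrite ltNge; apply/negP => hle.
  have ft := ft2 sS.
  have := fmono t (s0 + e) (h t) Tt _ hle (ltW hS2).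
  have : 0 <= c * (h t - (s0 + e)) by rewrite mulr_ge0//; lra.
  lra.
(* h is arbitrary below T; clamping the argument makes it Lipschitz on R. *)
have maxT t : T <= Num.max t T by rewrite le_max lexx orbT.
have maxE t : T <= t -> Num.max t T = t by move=> /max_idPl.
exists (fun t => h (Num.max t T)), s0; split.
- by move=> t Tt; rewrite maxE//; exact: hP.
- by move=> t t' Tt Tt'; rewrite !maxE//; exact: hL.
- apply: (lipschitz_continuous _ (L / c)) => t t'.
  apply: le_trans (hL _ _ (maxT t) (maxT t')) _; apply: ler_wpM2l.
    have := fL 1 0 0 0; rewrite !subr0 normr1 normr0 addr0 mulr1 => L0.
    by rewrite divr_ge0 ?(ltW c0)//; exact: le_trans L0.
  have /orP[tT|tT] := le_total t T; have /orP[tT'|tT'] := le_total t' T;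
    rewrite ?(maxE _ tT) ?(maxE _ tT') ?(max_idPr tT) ?(max_idPr tT').
  + by rewrite subrr normr0.
  + rewrite !ler0_norm; lra.
  + rewrite !ger0_norm; lra.
  + by [].
- apply: cvg_trans hcvg; apply: near_eq_cvg; near=> t.
  by rewrite maxE//; near: t; exact: nbhs_pinfty_ge (num_real _).
- by rewrite ler_norml.
Unshelve. all: by end_near. Qed.

End RealFunctions.

(** * The inner product of the plane in coordinates *)

Section Plane.
Context {R : realType}.
Implicit Types (u v w x y z d : 'rV[R]_2) (A B D X Y H : set 'rV[R]_2).

Lemma dotE u v : dot u v = u 0 0 * v 0 0 + u 0 1 * v 0 1.
Proof.
rewrite /dot !big_ord_recl big_ord0 addr0.
by have -> : lift ord0 ord0 = 1 :> 'I_2 by exact/val_inj.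
Qed.

Lemma row2P u v : u 0 0 = v 0 0 -> u 0 1 = v 0 1 -> u = v.
Proof.
move=> h0 h1; apply/rowP => j.
case: (unliftP 0 j) => [i ->|->] //.
by have -> : lift 0 i = 1 by apply/val_inj; rewrite /= [i]ord1.
Qed.

Lemma dotC u v : dot u v = dot v u.
Proof. by rewrite !dotE; ring. Qed.

Lemma dotDl u v w : dot (u + v) w = dot u w + dot v w.
Proof. by rewrite !dotE !mxE; ring. Qed.

Lemma dotBl u v w : dot (u - v) w = dot u w - dot v w.
Proof. by rewrite !dotE !mxE; ring. Qed.

Lemma dotZl a u w : dot (a *: u) w = a * dot u w.
Proof. by rewrite !dotE !mxE; ring. Qed.

Lemma dotNl u w : dot (- u) w = - dot u w.
Proof. by rewrite !dotE !mxE; ring. Qed.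

Lemma dotDr u v w : dot w (u + v) = dot w u + dot w v.
Proof. by rewrite !dotE !mxE; ring. Qed.

Lemma dotBr u v w : dot w (u - v) = dot w u - dot w v.
Proof. by rewrite !dotE !mxE; ring. Qed.

Lemma dotZr a u w : dot w (a *: u) = a * dot w u.
Proof. by rewrite !dotE !mxE; ring. Qed.

Lemma dotNr u w : dot w (- u) = - dot w u.
Proof. by rewrite !dotE !mxE; ring. Qed.

Definition dotL := (dotDl, dotBl, dotZl, dotNl, dotDr, dotBr, dotZr, dotNr).

Lemma dot_ge0 u : 0 <= dot u u.
Proof. by rewrite dotE addr_ge0// -expr2 sqr_ge0. Qed.

Lemma dot_eq0 u : (dot u u == 0) = (u == 0).
Proof.
apply/eqP/eqP => [|->]; last by rewrite dotE !mxE mul0r addr0.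
rewrite dotE => h.
have h0 := sqr_ge0 (u 0 0); have h1 := sqr_ge0 (u 0 1).
apply: row2P; rewrite mxE; apply/eqP; rewrite -sqrf_eq0; apply/eqP; lra.
Qed.

Lemma dot_gt0 u : (0 < dot u u) = (u != 0).
Proof. by rewrite lt_def dot_ge0 andbT dot_eq0. Qed.

Lemma dot_perp u v : dot (perp u) (perp v) = dot u v.
Proof. by rewrite !dotE !mxE /=; ring. Qed.

Lemma dot_perpl u v : dot (perp u) v = - dot u (perp v).
Proof. by rewrite !dotE !mxE /=; ring. Qed.

Lemma dot_perpv u : dot u (perp u) = 0.
Proof. by rewrite !dotE !mxE /=; ring. Qed.

Lemma continuous_dot (T : topologicalType) (f g : T -> 'rV[R]_2) :
  continuous f -> continuous g -> continuous (fun p => dot (f p) (g p)).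
Proof.
move=> cf cg.
have c (h : T -> 'rV[R]_2) j : continuous h -> continuous (fun p => h p 0 j).
  move=> ch p.
  apply: (@continuous_comp _ _ _ h (fun u : 'rV[R]_2 => u 0 j)); first exact: ch.
  exact: coord_continuous.
rewrite (_ : (fun p => dot _ _) = fun p => f p 0 0 * g p 0 0 + f p 0 1 * g p 0 1).
  move=> p; have h0 := continuousM (c f 0 cf p) (c g 0 cg p).
  exact: (continuousD h0 (continuousM (c f 1 cf p) (c g 1 cg p))).
by apply/funext => p; rewrite dotE.
Qed.

(** * Convex combinations and separation of compact sets *)

Lemma convex_setP H : convex_set H <->
  forall x y (t : R), 0 <= t <= 1 -> H x -> H y -> H ((1 - t) *: x + t *: y).
Proof.
split=> [cH x y t /andP[t0 t1] Hx Hy | cH x y k].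
  have [k kE] : exists k : {i01 R}, k%:num = 1 - t.
    have h : (0 <= 1 - t <= 1) by lra.
    by exists (Itv01 (proj1 (andP h)) (proj2 (andP h))).
  have := cH x y k; rewrite !inE => /(_ Hx Hy).
  by rewrite /conv /= kE /unstable.onem opprB addrCA subrr addr0.
rewrite !inE => Hx Hy; have := cH x y (1 - k%:num).
rewrite opprB addrCA subrr addr0; apply => //.
by rewrite subr_ge0 lerBlDr lerDl ge0 le1.
Qed.

(** Written as the image of a product with the unit interval, so that compactness passes to it.
    Starting from D, one and two applications give the convex combinations of two and of three
    points of D. *)
Definition join X Y : set 'rV[R]_2 :=
  [set (1 - p.2) *: p.1.1 + p.2 *: p.1.2 | p in (X `*` Y) `*` `[0, 1]].

Lemma join_compact X Y : compact X -> compact Y -> compact (join X Y).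
Proof.
move=> cX cY; apply: continuous_compact; last first.
  by apply: compact_setX; [exact: compact_setX|exact: segment_compact].
apply: continuous_subspaceT => p.
have c2 : {for p, continuous (snd : ('rV[R]_2 * 'rV[R]_2) * R -> R)}.
  exact: cvg_snd.
have c1 : {for p, continuous (fst : ('rV[R]_2 * 'rV[R]_2) * R -> _)}.
  exact: cvg_fst.
have c11 : {for p, continuous (fun q : ('rV[R]_2 * 'rV[R]_2) * R => q.1.1)}.
  by apply: (continuous_comp c1); exact: cvg_fst.
have c12 : {for p, continuous (fun q : ('rV[R]_2 * 'rV[R]_2) * R => q.1.2)}.
  by apply: (continuous_comp c1); exact: cvg_snd.
have c3 := continuousB (@cst_continuous _ _ (1 : R) p) c2.
exact: (continuousD (continuousZ c3 c11) (continuousZ c2 c12)).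
Qed.

Lemma joinP X Y x y (t : R) : X x -> Y y -> 0 <= t <= 1 ->
  join X Y ((1 - t) *: x + t *: y).
Proof. by move=> Xx Yy t01; exists (x, y, t). Qed.

Lemma joinl X Y : Y !=set0 -> X `<=` join X Y.
Proof.
move=> [y Yy] x Xx; have := @joinP X Y x y 0 Xx Yy.
by rewrite scale0r subr0 scale1r addr0; apply; rewrite lexx ler01.
Qed.

Lemma joinr X Y : X !=set0 -> Y `<=` join X Y.
Proof.
move=> [x Xx] y Yy; have := @joinP X Y x y 1 Xx Yy.
by rewrite subrr scale0r scale1r add0r; apply; rewrite lexx ler01.
Qed.

Lemma join_sub X Y H : convex_set H -> X `<=` H -> Y `<=` H ->
  join X Y `<=` H.
Proof.
move=> /convex_setP cH XH YH _ [[[x y] t] [[/= Xx Yy] t01] <-].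
by apply: cH; auto.
Qed.

(** First variation: after division by t the hypothesis reads 0 <= 2 <d,z> + t |d|^2, which fails
    for small t if <d,z> < 0. *)
Lemma sqr_norm_min_ge0 z d (e : R) : 0 < e ->
  (forall t, 0 < t <= e -> dot z z <= dot (z + t *: d) (z + t *: d)) ->
  0 <= dot d z.
Proof.
move=> e0 h; rewrite leNgt; apply/negP => dz.
have dd := dot_ge0 d.
(* For t <= q one has t |d|^2 <= - <d,z> - q, so the quadratic term cannot compensate; the 1 keeps
   the denominator positive when d = 0. *)
pose q := - dot d z / (dot d d + 1).
have q0 : 0 < q by rewrite divr_gt0//; lra.
have qE : q * (dot d d + 1) = - dot d z by rewrite /q divfK//; lra.
have me : Num.min e q <= e by rewrite ge_min lexx.
have mq : Num.min e q <= q by rewrite ge_min lexx orbT.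
have m0 : 0 < Num.min e q by rewrite lt_min e0.
have := h (Num.min e q); rewrite m0 me => /(_ isT).
move: (Num.min e q) mq m0 => m mq m0.
rewrite !dotL [dot z d]dotC => h1.
have : 0 <= m * (2 * dot d z + m * dot d d) by lra.
rewrite pmulr_rge0// => h2.
have : m * dot d d <= q * dot d d by rewrite ler_wpM2r.
lra.
Qed.

(** The minimum is interior to the segment, so the first variation applies in both directions y - x
    and x - y, and the segment is orthogonal to z. *)
Lemma sqr_norm_min_join x y z (t : R) : z = (1 - t) *: x + t *: y ->
  0 < t < 1 ->
  (forall s, 0 <= s <= 1 ->
    dot z z <= dot ((1 - s) *: x + s *: y) ((1 - s) *: x + s *: y)) ->
  dot x z = dot z z /\ dot y z = dot z z.
Proof.
move=> zE t01 h.
have h1 : 0 <= dot (y - x) z.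
  apply: (@sqr_norm_min_ge0 _ _ (1 - t)); first lra.
  move=> s s1; have -> : z + s *: (y - x) = (1 - (t + s)) *: x + (t + s) *: y.
    by rewrite zE; apply: row2P; rewrite !mxE; ring.
  by apply: h; lra.
have h2 : 0 <= dot (x - y) z.
  apply: (@sqr_norm_min_ge0 _ _ t); first lra.
  move=> s s1; have -> : z + s *: (x - y) = (1 - (t - s)) *: x + (t - s) *: y.
    by rewrite zE; apply: row2P; rewrite !mxE; ring.
  by apply: h; lra.
have : dot z z = (1 - t) * dot x z + t * dot y z by rewrite {1}zE !dotL.
move: h1 h2; rewrite !dotL => h1 h2.
have -> : dot y z = dot x z by lra.
by move=> ->; split; ring.
Qed.

(** All three points lie on the line through z orthogonal to z, where the coordinate along [perp z]
    determines a point and vanishes at z. *)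
Lemma between {x y z} : z != 0 -> dot x z = dot z z -> dot y z = dot z z ->
  dot x (perp z) <= 0 -> 0 <= dot y (perp z) ->
  exists2 t : R, 0 <= t <= 1 & z = (1 - t) *: x + t *: y.
Proof.
rewrite -dot_gt0 => z0 hx hy qx qy.
have eqz u : dot u z = dot z z -> dot u (perp z) = 0 -> u = z.
  move=> h1 h2; apply/eqP; rewrite -subr_eq0 -dot_eq0; apply/eqP.
  apply: (mulfI (lt0r_neq0 z0)); rewrite mulr0.
  have -> : dot z z * dot (u - z) (u - z) =
    (dot u z - dot z z) ^+ 2 + dot u (perp z) ^+ 2.
    by rewrite !dotE !mxE /=; ring.
  by rewrite h1 h2 subrr !expr0n addr0.
have [yx|yx] := eqVneq (dot y (perp z)) (dot x (perp z)).
  exists 0; first by rewrite lexx ler01.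
  rewrite subr0 scale1r scale0r addr0; apply/esym/eqz => //; lra.
have d0 : 0 < dot y (perp z) - dot x (perp z).
  by rewrite subr_gt0 lt_def yx (le_trans qx qy).
pose t := - dot x (perp z) / (dot y (perp z) - dot x (perp z)).
have tE : t * (dot y (perp z) - dot x (perp z)) = - dot x (perp z).
  by rewrite /t divfK// lt0r_neq0.
exists t.
  rewrite /t divr_ge0 ?oppr_ge0// ?(ltW d0)//= ler_pdivrMr//; lra.
apply/esym/eqz; rewrite !dotL ?hx ?hy; [ring|lra].
Qed.

(* The minimum z over all convex combinations of three points of D lies on a
   segment between two points of D: otherwise the three points lie on the
   line through z orthogonal to z, two of them on opposite sides of z.  Hence
   the combinations of z with a further point of D compete with z. *)
Lemma compact_separation D H : compact D -> D !=set0 -> convex_set H ->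
  D `<=` H -> ~ H 0 ->
  exists2 z, z != 0 & forall d, D d -> dot z z <= dot d z.
Proof.
move=> cD D0 cH DH H0.
pose D2 := join D D; pose D3 := join D2 D.
have D20 : D2 !=set0 by have [d Dd] := D0; exists d; exact: joinl.
have D30 : D3 !=set0 by have [d Dd] := D20; exists d; exact: joinl.
have cD3 : compact D3 by apply: join_compact => //; exact: join_compact.
have D3H : D3 `<=` H by apply: join_sub => //; exact: join_sub.
have cid : continuous (@id 'rV[R]_2) by move=> y; exact: cvg_id.
have csqr := continuous_subspaceT (continuous_dot _ _ _ cid cid).
have [z] := EVT_min_rV D30 cD3 (csqr _).
rewrite inE => D3z zmin.
have {}zmin y : D3 y -> dot z z <= dot y y by move=> ?; apply: zmin; rewrite inE.
have z0 : z != 0 by apply/eqP => z0; apply: H0; rewrite -z0; exact: D3H.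
exists z => //.
suff D2z : D2 z.
  move=> d Dd; rewrite -subr_ge0 -dotBl.
  apply: (@sqr_norm_min_ge0 _ _ 1) => // t t01; apply: zmin.
  have -> : z + t *: (d - z) = (1 - t) *: z + t *: d.
    by apply: row2P; rewrite !mxE; ring.
  by apply: joinP => //; lra.
case: (D3z) => [[[c d3] t] [[/= D2c Dd3] /= t01] zE].
rewrite in_itv/= in t01.
have [t0|tn0] := eqVneq t 0.
  by rewrite -zE t0 subr0 scale1r scale0r addr0.
have [t1|tn1] := eqVneq t 1.
  by rewrite -zE t1 subrr scale1r scale0r add0r; exact: joinr.
have {}t01 : 0 < t < 1 by rewrite !lt_neqAle eq_sym tn0 tn1.
have [cz d3z] : dot c z = dot z z /\ dot d3 z = dot z z.
  apply: (@sqr_norm_min_join _ _ _ t) => // s s01; apply: zmin.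
  exact: joinP.
case: (D2c) => [[[d1 d2] u] [[/= Dd1 Dd2] /= u01] cE].
rewrite in_itv/= in u01.
have [u0|un0] := eqVneq u 0.
  by rewrite -zE -cE u0 subr0 scale1r scale0r addr0; apply: joinP => //; lra.
have [u1|un1] := eqVneq u 1.
  by rewrite -zE -cE u1 subrr scale1r scale0r add0r; apply: joinP => //; lra.
have {}u01 : 0 < u < 1 by rewrite !lt_neqAle eq_sym un0 un1.
have moved (s : R) : 0 <= s <= 1 ->
    D3 ((1 - t) *: ((1 - s) *: d1 + s *: d2) + t *: d3).
  by move=> s01; apply: joinP => //; [exact: joinP|lra].
(* Varying the inner weight u in both directions, with t fixed, moves z along multiples of d2 - d1
   inside [D3]. *)
have d12 : dot d1 z = dot d2 z.
  have h1 : 0 <= dot ((1 - t) *: (d2 - d1)) z.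
    apply: (@sqr_norm_min_ge0 _ _ (1 - u)); first lra.
    move=> s s1; apply: zmin.
    rewrite (_ : z + _ =
      (1 - t) *: ((1 - (u + s)) *: d1 + (u + s) *: d2) + t *: d3).
      by apply: moved; lra.
    by rewrite -zE -cE; apply: row2P; rewrite !mxE; ring.
  have h2 : 0 <= dot ((1 - t) *: (d1 - d2)) z.
    apply: (@sqr_norm_min_ge0 _ _ u); first lra.
    move=> s s1; apply: zmin.
    rewrite (_ : z + _ =
      (1 - t) *: ((1 - (u - s)) *: d1 + (u - s) *: d2) + t *: d3).
      by apply: moved; lra.
    by rewrite -zE -cE; apply: row2P; rewrite !mxE; ring.
  have t1 : 0 < 1 - t by lra.
  by move: h1 h2; rewrite !dotZl !pmulr_rge0// !dotL; lra.
have d2z : dot d2 z = dot z z by rewrite -cz -cE !dotL d12; ring.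
have d1z : dot d1 z = dot z z by rewrite d12.
have q0 : (1 - t) * ((1 - u) * dot d1 (perp z) + u * dot d2 (perp z)) +
    t * dot d3 (perp z) = 0.
  by rewrite -(dot_perpv z) -{4}zE -cE !dotL.
have D2I x y : D x -> D y -> dot x z = dot z z -> dot y z = dot z z ->
    dot x (perp z) <= 0 -> 0 <= dot y (perp z) -> D2 z.
  move=> Dx Dy xz yz qx qy; have [s s01 ->] := between z0 xz yz qx qy.
  exact: joinP.
have /orP[q1|q1] := le_total (dot d1 (perp z)) 0;
have /orP[q2|q2] := le_total (dot d2 (perp z)) 0.
- apply: (D2I d1 d3) => //.
  rewrite leNgt; apply/negP => q3.
  have : t * dot d3 (perp z) < 0 by rewrite pmulr_rlt0//; lra.
  have : (1 - u) * dot d1 (perp z) <= 0 by rewrite pmulr_rle0//; lra.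
  have : u * dot d2 (perp z) <= 0 by rewrite pmulr_rle0//; lra.
  by nra.
- exact: (D2I d1 d2).
- exact: (D2I d2 d1).
- apply: (D2I d3 d1) => //.
  rewrite leNgt; apply/negP => q3.
  have : 0 < t * dot d3 (perp z) by rewrite pmulr_rgt0//; lra.
  have : 0 <= (1 - u) * dot d1 (perp z) by rewrite pmulr_rge0//; lra.
  have : 0 <= u * dot d2 (perp z) by rewrite pmulr_rge0//; lra.
  by nra.
Qed.

(** Separating A from B means separating B - A from 0. The difference [H] of the hulls is convex,
    contains B - A and misses 0, while compactness comes from B - A itself. *)
Lemma ch_disjoint_separated A B : A !=set0 -> B !=set0 ->
  compact A -> compact B -> ch_disjoint A B ->
  exists u, exists2 c : R, 0 < c &
    forall a b, A a -> B b -> c <= dot (b - a) (perp u).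
Proof.
move=> [a0 Aa0] [b0 Bb0] cA cB hAB.
pose sub (p : 'rV[R]_2 * 'rV[R]_2) := p.2 - p.1.
pose H := [set sub p | p in convex_hull A `*` convex_hull B].
pose D := [set sub p | p in A `*` B].
have hullP X : convex_set (convex_hull X).
  apply/convex_setP => x y t t01 hx hy Z cZ.
  by apply: (proj1 (convex_setP Z) cZ.1) => //; [exact: hx|exact: hy].
have csub : continuous sub.
  move=> p; apply: (@continuousB _ _ _ snd fst); [exact: cvg_snd|exact: cvg_fst].
have cD : compact D.
  apply: continuous_compact; last exact: compact_setX.
  exact: continuous_subspaceT.
have D0 : D !=set0 by exists (b0 - a0); exists (a0, b0).
have cH : convex_set H.
  apply/convex_setP => _ _ t t01 [p [pA pB] <-] [q [qA qB] <-].
  exists ((1 - t) *: p.1 + t *: q.1, (1 - t) *: p.2 + t *: q.2).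
    by split; apply: (proj1 (convex_setP _) (hullP _)).
  by rewrite /sub /=; apply: row2P; rewrite !mxE; ring.
have DH : D `<=` H.
  by move=> _ [p [pA pB] <-]; exists p => //; split => Z [_ sZ]; exact: sZ.
have H0 : ~ H 0.
  move=> [[x y] [/= hx hy]] /eqP; rewrite /sub /= subr_eq0 => /eqP xy.
  suff : (convex_hull A `&` convex_hull B) x by rewrite hAB.
  by split; rewrite // -xy.
have [z z0 hz] := compact_separation _ _ cD D0 cH DH H0.
(* [perp] applied twice is - id, so this vector has [z] as its image under [perp]. *)
exists (- perp z); exists (dot z z); first by rewrite dot_gt0.
move=> a b Aa Bb.
have -> : perp (- perp z) = z by apply: row2P; rewrite !mxE /= ?mxE /= ?opprK.
by apply: hz; exists (a, b).
Qed.

(** * Support function, power function and distance *)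

Definition support A x : R := sup [set dot x a | a in A].

Definition power A x : R := sup [set 2 * dot x a - dot a a | a in A].

Lemma sup_compact (f : 'rV[R]_2 -> R) A : A !=set0 -> compact A ->
  continuous f ->
  exists a, [/\ A a, sup [set f b | b in A] = f a &
                forall b, A b -> f b <= f a].
Proof.
move=> A0 cA cf.
have [a /set_mem Aa amax] := EVT_max_rV A0 cA (continuous_subspaceT cf).
have {}amax b : A b -> f b <= f a by move=> Ab; exact/amax/mem_set.
exists a; split=> //; apply/eqP; rewrite eq_le; apply/andP; split.
  by apply: ge_sup; [exists (f a), a|move=> _ [b Ab <-]; exact: amax].
apply: ub_le_sup; last by exists a.
by exists (f a) => _ [b Ab <-]; exact: amax.
Qed.

Lemma supportP A x : A !=set0 -> compact A ->
  exists a, [/\ A a, support A x = dot x a &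
                forall b, A b -> dot x b <= support A x].
Proof.
move=> A0 cA; have cf : continuous (dot x).
  by apply: continuous_dot => y; [exact: cst_continuous|exact: cvg_id].
by have [a [Aa aE amax]] := sup_compact (dot x) _ A0 cA cf;
  exists a; split=> // b Ab; rewrite /support aE amax.
Qed.

Lemma powerP A x : A !=set0 -> compact A ->
  exists a, [/\ A a, power A x = 2 * dot x a - dot a a &
                forall b, A b -> 2 * dot x b - dot b b <= power A x].
Proof.
move=> A0 cA; pose f b := 2 * dot x b - dot b b.
have cid : continuous (@id 'rV[R]_2) by move=> y; exact: cvg_id.
have cf : continuous f.
  have c1 : continuous (dot (2 *: x)).
    by apply: continuous_dot => // y; exact: cst_continuous.
  rewrite (_ : f = fun b => dot (2 *: x) b - dot b b); last first.
    by apply/funext => b; rewrite /f dotZl.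
  by move=> y; exact: (continuousB (c1 y) (continuous_dot _ _ _ cid cid y)).
by have [a [Aa aE amax]] := sup_compact f _ A0 cA cf;
  exists a; split=> // b Ab; rewrite /power aE; exact: amax.
Qed.

(** Expanding |x - a|^2 turns minimal distance into maximal 2 <x,a> - |a|^2. The inequality keeps
    the radicand nonnegative, where the square root is injective. *)
Lemma distE A x : A !=set0 -> compact A ->
  power A x <= dot x x /\ dist x A = Num.sqrt (dot x x - power A x).
Proof.
move=> A0 cA; have [a [Aa aE amax]] := powerP _ x A0 cA.
have nE b : dot (x - b) (x - b) = dot x x - (2 * dot x b - dot b b).
  by rewrite !dotL [dot b x]dotC; ring.
have pE : dot x x - power A x = dot (x - a) (x - a) by rewrite nE aE.
split; first by rewrite -subr_ge0 pE dot_ge0.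
rewrite pE; apply/eqP; rewrite eq_le; apply/andP; split.
  apply: ge_inf; last by exists a.
  by exists 0 => _ [b Ab <-]; exact: sqrtr_ge0.
apply: lb_le_inf; first by exists (eucl_norm (x - a)); exists a.
move=> _ [b Ab <-]; apply: ler_wsqrtr.
by rewrite -pE nE lerD2l lerN2 amax.
Qed.

Lemma equidistantP A B x : A !=set0 -> B !=set0 -> compact A -> compact B ->
  equidistant A B x <-> power A x = power B x.
Proof.
move=> A0 B0 cA cB; rewrite /equidistant /=.
have [pA ->] := distE _ x A0 cA; have [pB ->] := distE _ x B0 cB.
split=> [/eqP|->//]; rewrite eqr_sqrt ?subr_ge0// => /eqP; lra.
Qed.

Lemma support_scale A x (t : R) : A !=set0 -> compact A -> 0 <= t ->
  support A (t *: x) = t * support A x.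
Proof.
move=> A0 cA t0.
have [a [Aa aE amax]] := supportP _ x A0 cA.
have [b [Ab bE bmax]] := supportP _ (t *: x) A0 cA.
apply/eqP; rewrite eq_le bE !dotZl; apply/andP; split.
  by rewrite ler_wpM2l// amax.
by rewrite aE -dotZl -(dotZl t x b) -bE bmax.
Qed.

Lemma compact_sqr_norm_bound A : A !=set0 -> compact A ->
  exists2 m : R, 0 <= m & forall a, A a -> dot a a <= m.
Proof.
move=> A0 cA; have cid : continuous (@id 'rV[R]_2) by move=> y; exact: cvg_id.
have [a [_ _ amax]] := sup_compact _ _ A0 cA (continuous_dot _ _ _ cid cid).
by exists (dot a a); rewrite ?dot_ge0.
Qed.

End Plane.

(** * Asymptotics of support and power functions along a ray *)

Section AsymptoticEnd.
Context {R : realType}.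
Implicit Types (u v x y a b : 'rV[R]_2) (A B X : set 'rV[R]_2) (t s : R).

(** From |u + a|^2 >= 0 and |u - a|^2 >= 0; it stands in for Cauchy-Schwarz and avoids square
    roots. *)
Lemma dot_bound u a : `|dot u a| <= (dot u u + dot a a) / 2.
Proof.
have := dot_ge0 (u - a); have := dot_ge0 (u + a).
rewrite !dotL [dot a u]dotC => h1 h2.
by rewrite ler_norml; apply/andP; split; lra.
Qed.

Lemma orthonormal_decomp v x : dot v v = 1 ->
  x = dot x v *: v + dot x (perp v) *: perp v.
Proof.
rewrite dotE => v1; apply: row2P; rewrite !mxE !dotE !mxE /=.
  by transitivity (x 0 0 * (v 0 0 * v 0 0 + v 0 1 * v 0 1)); [rewrite v1|]; ring.
by transitivity (x 0 1 * (v 0 0 * v 0 0 + v 0 1 * v 0 1)); [rewrite v1|]; ring.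
Qed.

Lemma eucl_norm_eq1 v : eucl_norm v = 1 <-> dot v v = 1.
Proof.
rewrite /eucl_norm; split=> [h|->]; last exact: sqrtr1.
by rewrite -[LHS]sqr_sqrtr ?dot_ge0// h expr1n.
Qed.

Lemma setC_eucl_ball (rho : R) x : 0 < rho ->
  (~` eucl_ball rho) x <-> rho ^+ 2 <= dot x x.
Proof.
move=> rho0; rewrite /eucl_ball /setC /= /eucl_norm.
have -> : (Num.sqrt (dot x x) < rho) = ~~ (rho ^+ 2 <= dot x x).
  by rewrite -ltNge -[RHS]ltr_sqrt ?exprn_gt0// sqrtr_sqr gtr0_norm.
by split=> [/negP/negPn|h /negP].
Qed.

(** The graph description yields the bijection: the projection of [tube_point r t s] depends on t
    alone, and t can be recovered from it. *)
Lemma graph_asymptotic_end (M : set 'rV[R]_2) (r : ray R) (eps : R)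
    (g : R -> R) : 0 < eps -> (forall t, 0 <= t -> `|g t| <= eps) ->
  M `&` tube eps r = [set tube_point r t (g t) | t in `[0, +oo[] ->
  g t @[t --> +oo] --> 0 -> asymptotic_end M r eps.
Proof.
move=> eps0 ge gM g0; split=> //; last by exists g.
have v1 := proj1 (eucl_norm_eq1 _) (ray_dir_unit r).
have projE t s : ray_proj r (tube_point r t s) = ray_origin r + t *: ray_dir r.
  rewrite /ray_proj /tube_point; congr (_ + _ *: _).
  by rewrite !dotL v1 [dot (perp _) _]dotC dot_perpv; ring.
rewrite gM; split.
- by move=> _ [t t0 <-]; rewrite projE; exists t.
- move=> _ _ /set_mem[t _ <-] /set_mem[t' _ <-]; rewrite !projE => /addrI tt'.
  suff -> : t = t' by [].
  by have := congr1 (fun u => dot u (ray_dir r)) tt'; rewrite /= !dotZl v1 !mulr1.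
- move=> _ [t t0 <-]; exists (tube_point r t (g t)); last exact: projE.
  by exists t.
Qed.

Lemma support_ge A x a : A !=set0 -> compact A -> A a -> dot x a <= support A x.
Proof. by move=> A0 cA; have [_ [_ _]] := supportP _ x A0 cA; apply. Qed.

Lemma power_ge A x a : A !=set0 -> compact A -> A a ->
  2 * dot x a - dot a a <= power A x.
Proof. by move=> A0 cA; have [_ [_ _]] := powerP _ x A0 cA; apply. Qed.

(** A maximizer at one point competes at the other. The same comparison drives the estimates for
    [power] and [gap]. *)
Lemma support_lipschitz A u x (m : R) : A !=set0 -> compact A ->
  (forall a, A a -> dot a a <= m) -> forall s t,
  `|support A (x + s *: u) - support A (x + t *: u)| <=
    (dot u u + m) / 2 * `|s - t|.
Proof.
move=> A0 cA hm.
have le s t : support A (x + s *: u) - support A (x + t *: u) <=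
    (dot u u + m) / 2 * `|s - t|.
  have [a [Aa -> _]] := supportP _ (x + s *: u) A0 cA.
  have := support_ge _ (x + t *: u) _ A0 cA Aa.
  have := dot_bound u a; have := hm _ Aa; rewrite !dotL => h1 h2 h3.
  apply: (@le_trans _ _ ((s - t) * dot u a)); first lra.
  apply: le_trans (ler_norm _) _; rewrite normrM mulrC ler_wpM2r//; lra.
by move=> s t; rewrite ler_norml lerNl opprB le andbT distrC le.
Qed.

Lemma power_lipschitz A v (m : R) : A !=set0 -> compact A -> dot v v = 1 ->
  (forall a, A a -> dot a a <= m) -> forall t t' s s',
  `|power A (t *: v + s *: perp v) - power A (t' *: v + s' *: perp v)| <=
    (1 + m) * (`|t - t'| + `|s - s'|).
Proof.
move=> A0 cA v1 hm.
have le t t' s s' :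
    power A (t *: v + s *: perp v) - power A (t' *: v + s' *: perp v) <=
    (1 + m) * (`|t - t'| + `|s - s'|).
  have [a [Aa -> _]] := powerP _ (t *: v + s *: perp v) A0 cA.
  have := power_ge _ (t' *: v + s' *: perp v) _ A0 cA Aa.
  have := dot_bound v a; have := dot_bound (perp v) a; have := hm _ Aa.
  rewrite dot_perp v1 !dotL => h1 h2 h3 h4.
  apply: (@le_trans _ _ (2 * ((t - t') * dot v a + (s - s') * dot (perp v) a))).
    lra.
  have bound p q : `|q| <= (1 + dot a a) / 2 -> p * q <= (1 + m) / 2 * `|p|.
    move=> hq; apply: le_trans (ler_norm _) _.
    rewrite normrM mulrC ler_wpM2r//; lra.
  have := bound (t - t') _ h3; have := bound (s - s') _ h2; lra.
move=> t t' s s'; rewrite ler_norml lerNl opprB le andbT.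
by rewrite [`|t - t'|]distrC [`|s - s'|]distrC le.
Qed.

Lemma power_ray A v (m t : R) : A !=set0 -> compact A ->
  (forall a, A a -> dot a a <= m) -> 0 <= t ->
  2 * t * support A v - m <= power A (t *: v) <= 2 * t * support A v.
Proof.
move=> A0 cA hm t0; apply/andP; split.
  have [a [Aa -> _]] := supportP _ v A0 cA.
  by have := power_ge _ (t *: v) _ A0 cA Aa; have := hm _ Aa;
    rewrite dotZl; lra.
have [a [Aa -> _]] := powerP _ (t *: v) A0 cA.
have := ler_wpM2l t0 (support_ge _ v _ A0 cA Aa); have := dot_ge0 a.
by rewrite dotZl; lra.
Qed.

(** A point of A on the support line competes with [a]: the loss in the term linear in t must be
    offset by terms bounded in t. Hence [a] is within O(1/t) of the support line. *)
Lemma power_argmax_near_face A v (m S t s : R) a : A !=set0 -> compact A ->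
  dot v v = 1 -> (forall a, A a -> dot a a <= m) -> `|s| <= S -> A a ->
  power A (t *: v + s *: perp v) =
    2 * dot (t *: v + s *: perp v) a - dot a a ->
  t * (support A v - dot v a) <= S * (1 + m) + m / 2.
Proof.
move=> A0 cA v1 hm sS Aa aE.
have [a' [Aa' a'E _]] := supportP _ v A0 cA.
have := power_ge _ (t *: v + s *: perp v) _ A0 cA Aa'.
have := dot_bound (perp v) a; have := dot_bound (perp v) a'.
have := hm _ Aa; have := hm _ Aa'; have := dot_ge0 a; have := dot_ge0 a'.
rewrite aE a'E dot_perp v1 !dotL => h1 h2 h3 h4 h5 h6 h7.
have : s * (dot (perp v) a - dot (perp v) a') <= S * (1 + m).
  apply: le_trans (ler_norm _) _; rewrite normrM; apply: ler_pM => //.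
  by apply: le_trans (ler_normB _ _) _; lra.
lra.
Qed.

(** With 2 t h subtracted, each competitor b is affine in t with slope 2 (<v,b> - h) <= 0, and a
    competitor on the support line is constant, which bounds the supremum below. *)
Lemma power_cvg A v s : A !=set0 -> compact A ->
  exists l : R,
    (fun t => power A (t *: v + s *: perp v) - 2 * t * support A v) @ +oo --> l.
Proof.
move=> A0 cA.
pose f t := power A (t *: v + s *: perp v) - 2 * t * support A v.
have [a [Aa aE _]] := supportP _ v A0 cA.
exists (inf (range f)).
apply: (nonincreasing_cvgr_pinfty f (2 * s * dot (perp v) a - dot a a)).
  move=> t t' tt'; rewrite /f.
  have [b [Ab -> _]] := powerP _ (t' *: v + s *: perp v) A0 cA.
  have := power_ge _ (t *: v + s *: perp v) _ A0 cA Ab.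
  have := support_ge _ v _ A0 cA Ab; rewrite -subr_ge0 => h1.
  have : 0 <= (t' - t) * (support A v - dot v b) by rewrite mulr_ge0// subr_ge0.
  by rewrite !dotL; lra.
move=> t; rewrite /f aE.
by have := power_ge _ (t *: v + s *: perp v) _ A0 cA Aa; rewrite !dotL; lra.
Qed.

(** The second clause lets the tubes for e and - e cover all of M; the strict inequalities in the
    last two keep the two ends, and the two rays, disjoint. *)
Definition half_plane_end A B (e : 'rV[R]_2) (rho : R) : Prop :=
  exists (r : ray R) (eps : R),
    let M := equidistant A B `&` ~` eucl_ball rho in
    [/\ asymptotic_end M r eps,
        M `&` tube eps r = M `&` [set x | 0 <= dot x e],
        M `&` [set x | 0 <= dot x e] `<=` [set x | 0 < dot x e] &
        ray_set r `<=` [set x | 0 < dot x e]].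

(** * The end in one half plane *)

Section HalfPlane.
Context A B (e : 'rV[R]_2) (c : R).
Hypotheses (A0 : A !=set0) (B0 : B !=set0) (cA : compact A) (cB : compact B).
Hypotheses (c0 : 0 < c)
  (sep : forall a b, A a -> B b -> c <= dot (b - a) (perp e)).

Let gap x := power B x - power A x.

(** The maximizer b of [power B] at the lower point and a of [power A] at the upper one bound the
    increment below by 2 t <b - a, perp e>. *)
Lemma gap_increasing x t : 0 <= t -> gap x + 2 * c * t <= gap (x + t *: perp e).
Proof.
move=> t0; rewrite /gap.
have [b [Bb bE _]] := powerP _ x B0 cB.
have [a [Aa aE _]] := powerP _ (x + t *: perp e) A0 cA.
have := power_ge _ (x + t *: perp e) _ B0 cB Bb.
have := power_ge _ x _ A0 cA Aa.
have := ler_wpM2l t0 (sep _ _ Aa Bb).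
rewrite aE bE !dotL [dot b (perp e)]dotC [dot a (perp e)]dotC; lra.
Qed.

(** Along the directions e + t perp e the difference [F] of the support values grows with slope at
    least c, so it has a zero; normalizing that direction gives v. *)
Lemma common_support_direction :
  exists v, [/\ dot v v = 1, 0 < dot e v & support A v = support B v].
Proof.
have e0 : 0 < dot e e.
  rewrite dot_gt0; apply/eqP => e0.
  have [a Aa] := A0; have [b Bb] := B0; have := sep _ _ Aa Bb.
  by rewrite e0 dotE !mxE /= oppr0 !mulr0 addr0 leNgt c0.
have [m mge0 hm] := compact_sqr_norm_bound _ A0 cA.
have [m' m'ge0 hm'] := compact_sqr_norm_bound _ B0 cB.
pose F t := support B (e + t *: perp e) - support A (e + t *: perp e).
have Fmono s t : s <= t -> F s + c * (t - s) <= F t.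
  move=> st; rewrite /F.
  have [b [Bb bE _]] := supportP _ (e + s *: perp e) B0 cB.
  have [a [Aa aE _]] := supportP _ (e + t *: perp e) A0 cA.
  have := support_ge _ (e + t *: perp e) _ B0 cB Bb.
  have := support_ge _ (e + s *: perp e) _ A0 cA Aa.
  have ts : 0 <= t - s by rewrite subr_ge0.
  have := ler_wpM2l ts (sep _ _ Aa Bb).
  rewrite aE bE !dotL [dot b (perp e)]dotC [dot a (perp e)]dotC; lra.
have cF : continuous F.
  apply: (lipschitz_continuous _
    ((dot (perp e) (perp e) + m') / 2 + (dot (perp e) (perp e) + m) / 2)).
  move=> s t; have hA := support_lipschitz _ (perp e) e _ A0 cA hm s t.
  have hB := support_lipschitz _ (perp e) e _ B0 cB hm' s t.
  rewrite /F mulrDl; apply: le_trans (lerD hB hA).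
  apply: le_trans (ler_normB _ _); rewrite le_eqVlt; apply/orP; left.
  by apply/eqP; congr `|_|; ring.
(* With slope at least c, a distance |F 0| / c from 0 is enough for [F] to reach either sign. *)
have N0 : 0 <= `|F 0| / c by rewrite divr_ge0// ltW.
have cN : c * (`|F 0| / c) = `|F 0| by rewrite mulrC divfK// lt0r_neq0.
have F0 := ler_norm (F 0); have F0' := ler_norm (- F 0); rewrite normrN in F0'.
have [|||t _ Ft] := continuous_root F (- (`|F 0| / c)) (`|F 0| / c) cF.
- lra.
- have := Fmono (- (`|F 0| / c)) 0; rewrite sub0r opprK cN; lra.
- have := Fmono 0 (`|F 0| / c); rewrite subr0 cN; lra.
pose u := e + t *: perp e.
have eu : dot e u = dot e e by rewrite /u !dotL dot_perpv; ring.
have u0 : 0 < dot u u.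
  rewrite dot_gt0; apply/eqP => u0; move: e0; rewrite -eu u0.
  by rewrite dotE !mxE !mulr0 addr0 ltxx.
have n0 : 0 < Num.sqrt (dot u u) by rewrite sqrtr_gt0.
exists ((Num.sqrt (dot u u))^-1 *: u); split.
- rewrite dotZl dotZr mulrA -invfM -expr2 sqr_sqrtr ?dot_ge0//.
  by rewrite mulVf// lt0r_neq0.
- by rewrite dotZr eu mulr_gt0// invr_gt0.
- rewrite !support_scale// ?invr_ge0 ?(ltW n0)//; congr (_ * _).
  by move: Ft; rewrite /F -/u; lra.
Qed.

Context (v : 'rV[R]_2) (m : R).
Hypotheses (v1 : dot v v = 1) (ev : 0 < dot e v)
  (hv : support A v = support B v) (m0 : 0 <= m)
  (hA : forall a, A a -> dot a a <= m) (hB : forall b, B b -> dot b b <= m).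

Let f t s := gap (t *: v + s *: perp v).

Lemma perp_decomp : perp e = dot (perp e) v *: v + dot e v *: perp v.
Proof. by rewrite -[dot e v]dot_perp; exact: orthonormal_decomp. Qed.

Lemma dot_frame t s :
  dot (t *: v + s *: perp v) e = t * dot e v - s * dot (perp e) v.
Proof. by rewrite !dotL dot_perpl [dot v e]dotC [dot v _]dotC; ring. Qed.

Lemma frame_sqr_norm t s :
  dot (t *: v + s *: perp v) (t *: v + s *: perp v) = t ^+ 2 + s ^+ 2.
Proof. by rewrite !dotL dot_perp v1 [dot (perp v) v]dotC dot_perpv; ring. Qed.

(** The point is reached from p v, p >= 0, by moving q along perp e. On the ray the terms 2 p h
    cancel and |gap| <= m, while for |q| >= (m + 1) / c the slope 2c contributes at least 2 (m +
    1). *)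
Lemma gap_sign t s : 0 <= t * dot e v - s * dot (perp e) v ->
  (dot e v * (m + 1) <= c * s -> 0 < f t s) /\
  (c * s <= - (dot e v * (m + 1)) -> f t s < 0).
Proof.
move=> y0.
pose q := s / dot e v; pose p := t - q * dot (perp e) v.
have qE : q * dot e v = s by rewrite /q divfK// lt0r_neq0.
have p0 : 0 <= p.
  rewrite -(pmulr_rge0 _ ev) /p.
  suff -> : dot e v * (t - q * dot (perp e) v) =
    t * dot e v - s * dot (perp e) v by [].
  by rewrite -qE; ring.
have xE : t *: v + s *: perp v = p *: v + q *: perp e.
  rewrite [in RHS]perp_decomp -qE /p; apply: row2P; rewrite !mxE; ring.
have := power_ray _ v _ _ A0 cA hA p0; have := power_ray _ v _ _ B0 cB hB p0.
rewrite hv => /andP[h1 h2] /andP[h3 h4].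
have q_le p' : p' * dot e v <= s * c -> p' <= q * c.
  by move=> h; rewrite -(ler_pM2r ev) mulrAC qE.
have q_ge p' : s * c <= p' * dot e v -> q * c <= p'.
  by move=> h; rewrite -(ler_pM2r ev) mulrAC qE.
split=> hs.
  have hq : m + 1 <= q * c by apply: q_le; lra.
  have q0 : 0 <= q by rewrite -(pmulr_lge0 _ c0); lra.
  have := gap_increasing (p *: v) _ q0; rewrite -xE /f /gap; lra.
have hq : q * c <= - (m + 1) by apply: q_ge; lra.
have q0 : 0 <= - q by rewrite oppr_ge0 -(pmulr_lle0 _ c0); lra.
have := gap_increasing (p *: v + q *: perp e) _ q0.
by rewrite scaleNr addrK -xE /f /gap; lra.
Qed.

(** Split <b - a, perp e> >= c in the frame v, perp v. For such t the maximizers are so close to the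
    common support line that the v part is at most c / 2, and the remaining c / 2 bounds <b - a,
    perp v> below. *)
Lemma gap_slope (S t s s' : R) : 0 < t ->
  2 * `|dot (perp e) v| * (S * (1 + m) + m / 2) <= c * t ->
  - S <= s -> s <= s' -> s' <= S ->
  c / dot e v * (s' - s) <= f t s' - f t s.
Proof.
move=> t0 tS Ss ss' s'S; rewrite /f /gap.
set D := S * (1 + m) + m / 2 in tS.
have [b [Bb bE _]] := powerP _ (t *: v + s *: perp v) B0 cB.
have [a [Aa aE _]] := powerP _ (t *: v + s' *: perp v) A0 cA.
have sS : `|s| <= S by rewrite ler_norml; apply/andP; split; lra.
have s'S' : `|s'| <= S by rewrite ler_norml; apply/andP; split; lra.
have nb := power_argmax_near_face _ _ _ _ _ _ _ B0 cB v1 hB sS Bb bE.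
have na := power_argmax_near_face _ _ _ _ _ _ _ A0 cA v1 hA s'S' Aa aE.
rewrite -/D hv in na; rewrite -/D in nb.
have fb := support_ge _ v _ B0 cB Bb; have fa := support_ge _ v _ A0 cA Aa.
rewrite hv in fa.
have := power_ge _ (t *: v + s' *: perp v) _ B0 cB Bb.
have := power_ge _ (t *: v + s *: perp v) _ A0 cA Aa.
rewrite aE bE !dotL => h1 h2.
have hw : dot (b - a) (perp e) = dot (perp e) v * (dot v b - dot v a) +
    dot e v * (dot (perp v) b - dot (perp v) a).
  by rewrite {1}perp_decomp !dotL ![dot _ v]dotC ![dot _ (perp v)]dotC; ring.
have hn : `|t * (dot v b - dot v a)| <= D.
  have na0 : 0 <= t * (support B v - dot v a) by rewrite mulr_ge0 ?subr_ge0// ltW.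
  have nb0 : 0 <= t * (support B v - dot v b) by rewrite mulr_ge0 ?subr_ge0// ltW.
  by rewrite ler_norml; apply/andP; split; lra.
have ht : dot (perp e) v * (dot v b - dot v a) <= c / 2.
  rewrite -(ler_pM2l t0).
  have : dot (perp e) v * (t * (dot v b - dot v a)) <= `|dot (perp e) v| * D.
    by apply: le_trans (ler_norm _) _; rewrite normrM ler_wpM2l.
  lra.
have := sep _ _ Aa Bb; rewrite hw => hc.
have hk : c / dot e v <= 2 * (dot (perp v) b - dot (perp v) a).
  rewrite ler_pdivrMr//; lra.
have ds : 0 <= s' - s by rewrite subr_ge0.
have := ler_wpM2r ds hk; lra.
Qed.

Lemma gap_lipschitz t t' s s' :
  `|f t s - f t' s'| <= 2 * (1 + m) * (`|t - t'| + `|s - s'|).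
Proof.
have h1 := power_lipschitz _ _ _ A0 cA v1 hA t t' s s'.
have h2 := power_lipschitz _ _ _ B0 cB v1 hB t t' s s'.
rewrite /f /gap; move: h1 h2; rewrite !ler_norml => /andP[? ?] /andP[? ?].
by apply/andP; split; lra.
Qed.

(** The divergent terms 2 t h of A and B cancel because the support values agree. *)
Lemma gap_cvg s : exists l : R, (f^~ s) @ +oo --> l.
Proof.
have [l lP] := power_cvg _ v s B0 cB; have [l' l'P] := power_cvg _ v s A0 cA.
exists (l - l'); rewrite (_ : (f^~ s) = fun t =>
  (power B (t *: v + s *: perp v) - 2 * t * support B v) -
  (power A (t *: v + s *: perp v) - 2 * t * support A v)); first exact: cvgB.
by apply/funext => t; rewrite /f /gap hv; ring.
Qed.

(* Past t = T, the zeros of gap in the half plane are the points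
   t v + g(t) v^perp. *)
Record end_chart (T S : R) (g : R -> R) (l : R) : Prop := EndChart {
  chart_T_gt0 : 0 < T;
  chart_S_gt0 : 0 < S;
  chart_pos : forall t s, T <= t -> `|s| <= 3 * S ->
    0 < t * dot e v - s * dot (perp e) v;
  chart_strip : forall t s, 0 <= t * dot e v - s * dot (perp e) v ->
    f t s = 0 -> `|s| < S;
  chart_zero : forall t, T <= t -> `|g t| < S /\ f t (g t) = 0;
  chart_unique : forall t s, T <= t -> `|s| < S -> f t s = 0 -> s = g t;
  chart_increasing : forall t t', T <= t -> t < t' ->
    t ^+ 2 + g t ^+ 2 < t' ^+ 2 + g t' ^+ 2;
  chart_continuous : continuous g;
  chart_cvg : g t @[t --> +oo] --> l;
  chart_limit : `|l| <= S }.

Lemma end_chart_exists : exists T S g l, end_chart T S g l.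
Proof.
have m_ge0 := m0; have c_gt0 := c0.
pose k := dot e v; have k0 : 0 < k := ev; pose al := dot (perp e) v.
(* [S] is the threshold of [gap_sign], so zeros in the half plane have |s| < S. *)
have [S SE] : exists S, c * S = k * (m + 1).
  by exists (k * (m + 1) / c); rewrite mulrC divfK// lt0r_neq0.
have S0 : 0 < S by rewrite -(pmulr_rgt0 _ c0) SE mulr_gt0//; lra.
pose D := S * (1 + m) + m / 2.
have D0 : 0 <= D.
  have : 0 <= S * (1 + m) by rewrite mulr_ge0 ?(ltW S0)//; lra.
  rewrite /D; lra.
have ck0 : 0 < c / k by rewrite divr_gt0.
have [L LE] : exists L, L = 2 * (1 + m) / (c / k) by eexists.
have L0 : 0 <= L by rewrite LE divr_ge0 ?(ltW ck0)//; lra.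
have al0 : 0 <= `|al| by [].
have [T1 T1E] : exists T1, c * T1 = 2 * `|al| * D.
  by exists (2 * `|al| * D / c); rewrite mulrC divfK// lt0r_neq0.
have [T2 T2E] : exists T2, k * T2 = 3 * S * `|al|.
  by exists (3 * S * `|al| / k); rewrite mulrC divfK// lt0r_neq0.
have T10 : 0 <= T1 by rewrite -(pmulr_rge0 _ c0) T1E !mulr_ge0.
have T20 : 0 <= T2 by rewrite -(pmulr_rge0 _ k0) T2E !mulr_ge0// ltW.
have SL0 : 0 <= S * L by rewrite mulr_ge0// ltW.
(* [T1] serves [gap_slope]; [T2] keeps the strip |s| <= 3 S in the half plane, which will contain a
   tube of half-width 2 S about s = l with |l| <= S; S * L serves the growth of t^2 + g(t)^2. *)
pose T := 1 + T1 + T2 + S * L.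
have T0 : 0 < T by rewrite /T; lra.
have TD t : T <= t -> 2 * `|al| * D <= c * t.
  by move=> Tt; rewrite -T1E ler_pM2l//; move: Tt; rewrite /T; lra.
have Ty t s : T <= t -> `|s| <= 3 * S -> 0 < t * k - s * al.
  move=> Tt sS; have h1 : s * al <= 3 * S * `|al|.
    by apply: le_trans (ler_norm _) _; rewrite normrM ler_wpM2r.
  have : k * T2 < k * t by rewrite ltr_pM2l//; move: Tt; rewrite /T; lra.
  lra.
have SS : `|S| <= 3 * S by rewrite gtr0_norm//; lra.
have SN : `|- S| <= 3 * S by rewrite normrN.
have slope t s s' : T <= t -> - S <= s -> s <= s' -> s' <= S ->
    c / k * (s' - s) <= f t s' - f t s.
  by move=> Tt; apply: gap_slope; [lra|exact: TD].
have [|g [l [gP gL cg gl lS]]] := asymptotic_root f T S (c / k) (2 * (1 + m))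
  ck0 (ltW S0) slope gap_lipschitz _ gap_cvg.
  move=> t Tt; have := gap_sign t (- S); have := gap_sign t S.
  rewrite -/k -/al => h1 h2.
  have [h1' _] := h1 (ltW (Ty _ _ Tt SS)).
  have [_ h2'] := h2 (ltW (Ty _ _ Tt SN)).
  by split; [apply: h2'; lra|apply: h1'; lra].
have gS t : T <= t -> - S < g t < S.
  by move=> /gP[]; rewrite ltr_norml.
have guniq t s : T <= t -> `|s| < S -> f t s = 0 -> s = g t.
  rewrite ltr_norml => Tt /andP[/ltW s1 /ltW s2] fs; have [_ fg] := gP _ Tt.
  have /andP[g1 g2] := gS _ Tt.
  have /orP[sg|sg] := le_total s (g t); apply/eqP; rewrite eq_le sg ?andbT /=.
    rewrite -subr_le0 -(pmulr_rle0 _ ck0).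
    by apply: le_trans (slope t _ _ Tt s1 sg (ltW g2)) _; rewrite fs fg subrr.
  rewrite -subr_le0 -(pmulr_rle0 _ ck0).
  by apply: le_trans (slope t _ _ Tt (ltW g1) sg s2) _; rewrite fs fg subrr.
pose N t := t ^+ 2 + g t ^+ 2.
have Nmono t t' : T <= t -> t < t' -> N t < N t'.
  move=> Tt tt'; have Tt' : T <= t' by lra.
  have := gL _ _ Tt Tt'; rewrite distrC [`|t - t'|]distrC -LE.
  rewrite [`|t' - t|]gtr0_norm ?subr_gt0// => hL.
  (* The change of g^2 is at most 2 S L (t' - t), which the change (t' - t) (t + t') of t^2 exceeds
     since T > S L. *)
  have : `|(g t' - g t) * (g t' + g t)| <= L * (t' - t) * (2 * S).
    rewrite normrM; apply: ler_pM => //.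
    have /andP[? ?] := gS _ Tt; have /andP[? ?] := gS _ Tt'.
    by rewrite ler_norml; apply/andP; split; lra.
  rewrite ler_norml => /andP[h1 _].
  have : 0 < (t' - t) * (t + t' - 2 * S * L).
    by rewrite mulr_gt0 ?subr_gt0//; move: Tt; rewrite /T; lra.
  rewrite /N; lra.
exists T, S, g, l; split=> // t s y0 fts.
have [sg1 sg2] := gap_sign _ _ y0.
rewrite ltr_norml; apply/andP; split; rewrite ltNge -(ler_pM2l c0).
  by rewrite mulrN SE; apply/negP => /sg2; rewrite -/(f t s) fts ltxx.
by rewrite SE; apply/negP => /sg1; rewrite -/(f t s) fts ltxx.
Qed.

Lemma asymptotic_graph : exists rho0, 0 < rho0 /\
  forall rho, rho0 <= rho -> half_plane_end A B e rho.
Proof.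
have [T [S [g [l [T0 S0 Ty strip gP guniq Nmono cg gl lS]]]]] := end_chart_exists.
pose N t := t ^+ 2 + g t ^+ 2.
exists (T + S); split; first by rewrite addr_gt0.
move=> rho hrho; have rho0 : 0 < rho by lra.
(* At [t0] the graph meets the circle of radius rho: N T <= (T + S)^2 <= rho^2 <= N rho. *)
have [||||t0 /andP[Tt0 _] Nt0] := continuous_root (fun t => N t - rho ^+ 2) T rho.
- have cid : continuous (@id R) by move=> t; exact: cvg_id.
  move=> t.
  apply: (@continuousB _ _ _ N (cst (rho ^+ 2))); last exact: cst_continuous.
  exact: (continuousD (continuousM (cid t) (cid t)) (continuousM (cg t) (cg t))).
- lra.
- have [/ltW gT _] := gP _ (lexx T); rewrite subr_le0.
  have TS_ge0 : 0 <= T + S by lra.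
  apply: le_trans (ler_pM TS_ge0 TS_ge0 hrho hrho).
  apply: le_trans (lerD (lexx _) (sqr_le_of_norm gT)) _.
  by have := mulr_gt0 T0 S0; lra.
- have := sqr_ge0 (g rho); rewrite /N; lra.
have {}Nt0 := subr0_eq Nt0.
(* The ray lies on the asymptote s = l and starts at abscissa [t0]; in its tube the end is the graph
   of g(t0 + t) - l. *)
pose r := @Ray R (t0 *: v + l *: perp v) v (proj2 (eucl_norm_eq1 v) v1).
have tubeE t s : tube_point r t s = (t0 + t) *: v + (l + s) *: perp v.
  by rewrite /tube_point /=; apply: row2P; rewrite !mxE; ring.
(* The half-width 2 S suffices because |g| < S and |l| <= S. *)
exists r, (2 * S) => M.
have ME x : M x <-> gap x = 0 /\ rho ^+ 2 <= dot x x.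
  have eqP := equidistantP A B x A0 B0 cA cB.
  have ballP := setC_eucl_ball rho x rho0.
  split=> [[/eqP pE /ballP ?]|[h ?]]; first by rewrite /gap pE subrr.
  by split; [apply/eqP/esym/subr0_eq|apply/ballP].
have MP x : M x /\ 0 <= dot x e ->
    exists2 t, t0 <= t & x = t *: v + g t *: perp v.
  rewrite ME; rewrite [x](orthonormal_decomp v)//.
  move: (dot x v) (dot x (perp v)) => t s.
  rewrite dot_frame frame_sqr_norm => -[[fts h2] y0].
  have sS := strip _ _ y0 fts.
  have := large_abscissa (ltW T0) (ltW S0) (ltW sS) hrho h2.
  (* If t <= - T, the opposite point (-t, -s) is strictly inside the half plane, so (t, s) is
     outside it. *)
  rewrite ler_normr => /orP[Tt|nt]; last first.
    have := Ty (- t) (- s) nt; rewrite normrN !mulNr opprK => yneg.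
    by have : 0 < - (t * dot e v) + s * dot (perp e) v; [apply: yneg|]; lra.
  have sE : s = g t by exact: guniq.
  exists t; last by rewrite sE.
  rewrite leNgt; apply/negP => /(Nmono _ _ Tt); rewrite -sE ltNge.
  by rewrite -/(N t0) Nt0 h2.
have PM t : t0 <= t -> M (t *: v + g t *: perp v) /\
    0 < dot (t *: v + g t *: perp v) e.
  move=> tt0; have Tt := le_trans Tt0 tt0.
  have [/ltW gt ft] := gP _ Tt; split.
    apply/ME; split; first exact: ft.
    rewrite frame_sqr_norm -/(N t) -Nt0.
    have [<-//|ht] := eqVneq t0 t.
    by apply/ltW/Nmono; rewrite // lt_neqAle ht.
  by rewrite dot_frame; apply: Ty => //; lra.
have halfE : M `&` tube (2 * S) r = M `&` [set x | 0 <= dot x e].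
  apply/seteqP; split=> x /= [Mx].
    move=> [t [s [t_ge0 sS xE]]]; split=> //.
    rewrite xE tubeE dot_frame; apply/ltW/Ty; first lra.
    by apply: le_trans (ler_normD _ _) _; lra.
  move=> y0; have [t tt0 xE] := MP x (conj Mx y0); split=> //.
  exists (t - t0), (g t - l); rewrite tubeE !subrKC; split=> //.
    by rewrite subr_ge0.
  apply: le_trans (ler_normB _ _) _.
  by have [gt _] := gP t (le_trans Tt0 tt0); lra.
have gl0 : (fun t => g (t0 + t) - l) @ +oo --> (0 : R).
  apply/cvgrPdist_lt => eps eps0.
  have /cvgrPdist_lt/(_ _ eps0) [K [_ hK]] := gl.
  exists (K - t0); split; first exact: num_real.
  by move=> t /= Kt; rewrite sub0r normrN distrC; apply: hK => /=; lra.
split=> //.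
- apply: (graph_asymptotic_end M r (2 * S) (fun t => g (t0 + t) - l)) => //.
  + lra.
  + move=> t t_ge0; apply: le_trans (ler_normB _ _) _.
    have Tt : T <= t0 + t by lra.
    by have [gt _] := gP _ Tt; lra.
  + rewrite halfE; apply/seteqP; split=> x /=.
      move=> /MP[t tt0 ->]; exists (t - t0).
        by rewrite /= in_itv /= andbT subr_ge0.
      by rewrite tubeE !subrKC.
    move=> [t]; rewrite in_itv /= andbT => t_ge0 <-; rewrite tubeE subrKC.
    by have [|Mx /ltW] := PM (t0 + t); first by lra.
- by move=> x /MP[t tt0 ->]; exact: (PM t tt0).2.
- move=> _ [t t_ge0 <-]; rewrite /= in_itv /= andbT in t_ge0 *.
  have -> : t0 *: v + l *: perp v + t *: v = (t0 + t) *: v + l *: perp v.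
    by apply: row2P; rewrite !mxE; ring.
  by rewrite dot_frame; apply: Ty; lra.
Qed.

End HalfPlane.

(** * Combining the two half planes *)

Lemma half_plane_end_exists A B (e : 'rV[R]_2) (c : R) :
  A !=set0 -> B !=set0 -> compact A -> compact B -> 0 < c ->
  (forall a b, A a -> B b -> c <= dot (b - a) (perp e)) ->
  exists rho0, 0 < rho0 /\ forall rho, rho0 <= rho -> half_plane_end A B e rho.
Proof.
move=> A0 B0 cA cB c0 sep.
have [v [v1 ev hv]] := common_support_direction _ _ _ _ A0 B0 cA cB c0 sep.
have [m m0 hA] := compact_sqr_norm_bound _ A0 cA.
have [m' m'0 hB] := compact_sqr_norm_bound _ B0 cB.
apply: (asymptotic_graph _ _ _ _ A0 B0 cA cB c0 sep v (m + m')) => //.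
- lra.
- by move=> a /hA; lra.
- by move=> b /hB; lra.
Qed.

End AsymptoticEnd.

Theorem theorem12 (R : realType) (A B : set 'rV[R]_2)
    (hA0 : A !=set0) (hB0 : B !=set0)
    (hAcompact : compact A) (hBcompact : compact B)
    (hAconnected : connected A) (hBconnected : connected B)
    (hAB : ch_disjoint A B) :
  exists (rho : R) (r1 r2 : ray R),
    [/\ 0 < rho,
        ray_set r1 `&` ray_set r2 = set0 &
        let M := equidistant A B `&` ~` eucl_ball rho in
        exists e1 e2 : R,
          [/\ asymptotic_end M r1 e1,
              asymptotic_end M r2 e2,
              M = (M `&` tube e1 r1) `|` (M `&` tube e2 r2) &
              (M `&` tube e1 r1) `&` (M `&` tube e2 r2) = set0]].
Proof.
have [u [c c0 sep]] := ch_disjoint_separated _ _ hA0 hB0 hAcompact hBcompact hAB.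
(* Exchanging A and B reverses b - a, and [perp (- u)] reverses the normal, so the opposite half
   plane is an instance of the same result. *)
have sep' b a : B b -> A a -> c <= dot (a - b) (perp (- u)).
  move=> Bb Aa; rewrite (_ : dot _ _ = dot (b - a) (perp u)); first exact: sep.
  by rewrite !dotE !mxE /=; ring.
have [rho1 [rho1_gt0 end1]] :=
  half_plane_end_exists _ _ _ _ hA0 hB0 hAcompact hBcompact c0 sep.
have [rho2 [rho2_gt0 end2]] :=
  half_plane_end_exists _ _ _ _ hB0 hA0 hBcompact hAcompact c0 sep'.
have [|r1 [e1 [a1 t1 p1 s1]]] := end1 (rho1 + rho2); first lra.
have [|r2 [e2 [a2 t2 p2 s2]]] := end2 (rho1 + rho2); first lra.
have sym : equidistant B A = equidistant A B.
  by apply/seteqP; split=> x /esym.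
rewrite sym in a2 t2 p2.
exists (rho1 + rho2), r1, r2; split; first by rewrite addr_gt0.
  by apply/seteqP; split=> // x [/s1 /= h1 /s2 /=]; rewrite dotNr; lra.
move=> M; exists e1, e2; split=> //.
  (* The two closed half planes cover the plane. *)
  rewrite t1 t2 -setIUr; apply/esym/setIidPl => x _ /=; rewrite dotNr oppr_ge0.
  by have /orP := le_total 0 (dot x u).
apply/seteqP; split=> // x; rewrite t1 t2 => -[/p1 /= h1 /p2 /=].
by rewrite dotNr; lra.
Qed.
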